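(* For any partial matrix $\mathcal{A}$ over a field $\mathbb{F}$, $$\operatorname{tmr}(\mathcal{A})\le\operatorname{fmr}(\mathcal{A})\le\operatorname{mr}(\mathcal{A}).$$
   Context: A partial matrix over a field $\mathbb{F}$ is an $m\times n$ array $\mathcal{A}$ in which some entries are specified elements of $\mathbb{F}$ and the others are unspecified (denoted $?$). Its pattern of knowns is the set $J\subseteq\{1,\dots,m\}\times\{1,\dots,n\}$ of positions of specified entries. A completion is a matrix over $\mathbb{F}$ obtained by specifying all unspecified entries. The minimal rank $\operatorname{mr}(\mathcal{A})$ is the minimum of $\operatorname{rank} B$ over all completions $B$ of $\mathcal{A}$. The same notions apply to partial block matrices, where an unspecified block may be replaced by any matrix over $\mathbb{F}$ of the appropriate size. For $T\subseteq J$, $\mathcal{A}\mid T$ denotes the partial matrix keeping only the specified entries of $\mathcal{A}$ in positions in $T$ (all other positions are unspecified). A pattern $T$ is triangular if whenever $(i,j)\in T$ and $(k,l)\in T$, then $(i,l)\in T$ or $(k,j)\in T$. A triangular $T\subseteq J$ is a maximal triangular subpattern of $J$ if it is maximal under inclusion among triangular subsets of $J$. The triangular minimal rank is $$\operatorname{tmr}(\mathcal{A})=\max\{\operatorname{mr}(\mathcal{A}\mid T): T\subseteq J \text{ maximal triangular}\}.$$ For $b\in\mathbb{N}$ (positive integers), $\mathcal{A}\otimes I_b$ is the partial block matrix obtained by replacing each specified entry $a_{ij}$ by the block $a_{ij}I_b$ and each unspecified entry by a wholly unspecified $b\times b$ block. The fractional minimal rank is $$\operatorname{fmr}(\mathcal{A})=\inf_{b\in\mathbb{N}}\frac{\operatorname{mr}(\mathcal{A}\otimes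 I_b)}{b}.$$ *)

(* Defs.v *)
From HB Require Import structures.
From mathcomp Require Import all_boot all_order all_algebra.
From mathcomp Require Import boolp classical_sets reals.

Set Implicit Arguments.
Unset Strict Implicit.
Unset Printing Implicit Defensive.

Import Order.TTheory GRing.Theory Num.Theory.
Local Open Scope ring_scope.

Section PartialMatrix.
Variable F : fieldType.

(* [A i j = Some a] : the entry is specified, with value [a];
   [A i j = None]   : the entry is unspecified. *)
Definition pmatrix m n := 'M[option F]_(m, n).

Section Size.
Variables m n : nat.
Implicit Types (A : pmatrix m n) (B : 'M[F]_(m, n)) (J T : {set 'I_m * 'I_n}).

Definition knowns A : {set 'I_m * 'I_n} := [set p | isSome (A p.1 p.2)].

Definition completion A B : Prop := forall i j a, A i j = Some a -> B i j = a.

Lemma completion_rank_ex A :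
  exists r, `[< exists2 B, completion A B & \rank B = r >].
Proof.
pose B : 'M[F]_(m, n) := \matrix_(i, j) odflt 0 (A i j).
by exists (\rank B); apply/asboolP; exists B => // i j a Aij; rewrite mxE Aij.
Qed.

(* The classical [`[< _ >]] is needed: completability at a given rank is not
   decidable over an arbitrary field. *)
Definition mr A : nat := ex_minn (completion_rank_ex A).

Definition restrict A T : pmatrix m n :=
  \matrix_(i, j) if (i, j) \in T then A i j else None.

Definition triangular T : bool :=
  [forall p in T, forall q in T, ((p.1, q.2) \in T) || ((q.1, p.2) \in T)].

Definition maximal_triangular J T : bool :=
  maxset (fun S : {set 'I_m * 'I_n} => triangular S && (S \subset J)) T.

Lemma maximal_triangular_ex J : exists T, maximal_triangular J T.
Proof.
have P0 : triangular finset.set0 && (finset.set0 \subset J).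
  by rewrite finset.sub0set andbT; apply/forall_inP => p; rewrite inE.
by have [T maxT _] := @maxset_exists _
  (fun S => triangular S && (S \subset J)) _ P0; exists T.
Qed.

Definition tmr A : nat :=
  \max_(T : {set 'I_m * 'I_n} | maximal_triangular (knowns A) T)
    mr (restrict A T).

End Size.

(* An unspecified block is the same as a block of unspecified entries, so a
   partial block matrix is just a partial matrix, assembled blockwise. *)
Definition tensor_id m n (A : pmatrix m n) (b : nat) :
    pmatrix (\sum_(i < m) b)%N (\sum_(j < n) b)%N :=
  \mxblock_(i < m, j < n)
    if A i j is Some a then map_mx Some (a%:M : 'M[F]_b) else const_mx None.

Definition fmr_set (R : realType) m n (A : pmatrix m n) : set R :=
  [set x : R | exists2 b : nat, (0 < b)%N &
    x = (mr (tensor_id A b))%:R / b%:R]%classic.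
Arguments fmr_set R {m n} A.

(* [inf] returns 0 on sets without an infimum; this does not happen here. *)
Lemma has_inf_fmr_set (R : realType) m n (A : pmatrix m n) :
  has_inf (fmr_set R A).
Proof.
split; first by exists ((mr (tensor_id A 1))%:R / 1%:R); exists 1%N.
by exists 0 => _ [b _ ->]; rewrite divr_ge0 // ler0n.
Qed.

Definition fmr (R : realType) m n (A : pmatrix m n) : R := inf (fmr_set R A).

End PartialMatrix.

Arguments fmr_set {F} R {m n} A.
Arguments fmr {F} R {m n} A.

(* Main.v *)
(** Triangularity makes the supports of the rows nested, so the rows of the
    restricted matrix can be added one at a time, by decreasing support.  If the
    new row is, on its support, a combination of the rows already present, the
    same combination completes it at no cost in rank.  Otherwise a vector [y]
    supported on the known columns annihilates the previous rows but not the new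
    one; [y (x) I_b] then does the same for any completion of the matrix
    tensored with [I_b], whose rank must grow by [b].  Hence tensoring a
    triangular pattern with [I_b] multiplies the minimal rank by at least [b]. *)

Require Import Defs.
From mathcomp Require Import all_boot all_order all_algebra.
From mathcomp Require Import boolp reals.
Local Open Scope ring_scope.

Set Implicit Arguments.
Unset Strict Implicit.
Unset Printing Implicit Defensive.

Import Order.TTheory GRing.Theory Num.Theory.

Section MinimalRank.
Variables (F : fieldType) (m n : nat).
Implicit Types (A : pmatrix F m n) (B : 'M[F]_(m, n)).

Lemma mr_attained A : exists2 B, completion A B & \rank B = mr A.
Proof. by rewrite /mr; case: ex_minnP => r /asboolP. Qed.

Lemma mr_le A B : completion A B -> (mr A <= \rank B)%N.
Proof.
move=> cB; rewrite /mr; case: ex_minnP => r _; apply.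
by apply/asboolP; exists B.
Qed.

End MinimalRank.

Section TensorId.
Variables (F : fieldType) (m n : nat) (A : pmatrix F m n).

(** Trades flat indices for block indices, so that completions of the tensored matrix are handled
    block by block. *)
Lemma completion_tensorP b (C : 'M[F]_(\sum_(i < m) b, \sum_(j < n) b)) :
  completion (tensor_id A b) C <->
  (forall i j a, A i j = Some a -> submxblock C i j = a%:M).
Proof.
have tE i j k l : tensor_id A b (tagnat.Rank i k) (tagnat.Rank j l) =
    if A i j is Some a then Some ((a%:M : 'M_b) k l) else None.
  transitivity (submxblock (tensor_id A b) i j k l); first by rewrite !mxE.
  by rewrite mxblockK; case: (A i j) => [a|]; rewrite !mxE.
split=> [cC i j a Aij|cC p q a].
  by apply/matrixP => k l; rewrite 2!mxE; apply: cC; rewrite tE Aij mxE.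
rewrite -[p]tagnat.sigK -[q]tagnat.sigK.
case: (tagnat.sig p) (tagnat.sig q) => i k [j l].
rewrite -[tagnat.rank _]/(tagnat.Rank i k).
rewrite -[tagnat.rank (Tagged _ _)]/(tagnat.Rank j l).
rewrite tE; case Aij: (A i j) => [c|//] [<-].
by have /matrixP/(_ k l) := cC i j c Aij; rewrite [LHS]mxE.
Qed.

(** Tensoring a rank factorization of an optimal completion with [I_b] gives a completion that
    factors through dimension [b * mr A]. *)
Lemma mr_tensor_le b : (mr (tensor_id A b) <= b * mr A)%N.
Proof.
have [B cB <-] := mr_attained A.
pose L : 'M_(_, \sum_(k < \rank B) b) :=
  \mxblock_(i < m, k < \rank B) ((col_base B i k)%:M : 'M[F]_b).
pose W : 'M_(\sum_(k < \rank B) b, _) :=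
  \mxblock_(k < \rank B, j < n) ((row_base B k j)%:M : 'M[F]_b).
apply: (@leq_trans (\rank (L *m W))).
  apply/mr_le/completion_tensorP => i j a /cB <-.
  rewrite mul_mxblock mxblockK -[in RHS](mulmx_base B) mxE raddf_sum.
  by apply: eq_bigr => k _; rewrite -scalar_mxM.
apply: leq_trans (mxrankM_maxl _ _) (leq_trans (rank_leq_col _) _).
by rewrite sum_nat_const card_ord mulnC.
Qed.

End TensorId.

Section RankIncrement.
Variable F : fieldType.

(** [Y] kills the row space of [U] and is injective on that of [V], so the two meet trivially. *)
Lemma mxrank_adds_annihilated p q r b (U : 'M[F]_(p, r)) (V : 'M[F]_(q, r))
    (Y : 'M[F]_(r, b)) :
  U *m Y = 0 -> \rank (V *m Y) = q -> (\rank U + q <= \rank (U + V)%MS)%N.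
Proof.
move=> UY0 rVY.
have rV : \rank V = q.
  by apply/eqP; rewrite eqn_leq rank_leq_row -{1}rVY mxrankM_maxl.
rewrite mxrank_disjoint_sum ?rV //.
apply/eqP/rowV0P => w; rewrite sub_capmx => /andP[/submxP[u wU] /submxP[v wV]].
have : v *m (V *m Y) = 0 by rewrite mulmxA -wV wU -mulmxA UY0 mulmx0.
move/eqP; rewrite mulmx_free_eq0 ?/row_free ?rVY // => /eqP v0.
by rewrite wV v0 mul0mx.
Qed.

Lemma submx_separation p r (W : 'M[F]_(p, r)) (v : 'rV[F]_r) :
  ~~ (v <= W)%MS -> exists2 y : 'cV_r, W *m y = 0 & v *m y = 1%:M.
Proof.
rewrite submxE => /matrix0Pn[i [k]]; rewrite ord1 => vk.
(* A cokernel column of [W] that does not annihilate [v], scaled to take the value 1 on it. *)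
pose c := (v *m cokermx W) 0 k; exists (c^-1 *: col k (cokermx W)).
  by rewrite -scalemxAr colE mulmxA mulmx_coker mul0mx scaler0.
apply/matrixP => s t; rewrite -scalemxAr colE mulmxA -colE !ord1 2!mxE.
by rewrite mulVf // mxE.
Qed.

End RankIncrement.

Section NestedSupports.
Variables (F : fieldType) (m n : nat) (A : pmatrix F m n).

Definition row_support i : {set 'I_n} := [set l | isSome (A i l)].

Definition completes_row i (v : 'rV[F]_n) :=
  forall l a, A i l = Some a -> v 0 l = a.

Definition completes_block_row b i
    (C : 'M[F]_(\sum_(i < m) b, \sum_(j < n) b)) :=
  forall l a, A i l = Some a -> submxblock C i l = a%:M.

(** As [y] vanishes off the known columns of row [i], the product meets only scalar blocks and does
    not depend on how the unspecified ones are filled. *)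
Lemma block_row_mul b i v (C : 'M[F]_(\sum_(i < m) b, \sum_(j < n) b))
    (y : 'cV[F]_n) :
  completes_row i v -> completes_block_row i C ->
  (forall l, l \notin row_support i -> y l 0 = 0) ->
  submxcol C i *m \mxcol_(l < n) ((y l 0)%:M : 'M_b) = ((v *m y) 0 0)%:M.
Proof.
move=> cv cC y0; rewrite -[submxcol C i]submxrowK mul_mxrow_mxcol mxE raddf_sum.
apply: eq_bigr => l _; rewrite -submxblockEv.
have := y0 l; rewrite inE; case Ail: (A i l) => [a|] yl.
  by rewrite (cC _ _ Ail) (cv _ _ Ail) -scalar_mxM.
by rewrite yl // mulr0 raddf0 mulmx0 raddf0.
Qed.

(** Projection onto the coordinates in [K]; it turns agreement of rows on a support into row-space
    inclusion. *)
Definition mask (K : {set 'I_n}) : 'M[F]_n := diag_mx (\row_l (l \in K)%:R).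

Lemma mul_maskE p (K : {set 'I_n}) (B : 'M_(p, n)) i l :
  (B *m mask K) i l = if l \in K then B i l else 0.
Proof.
by rewrite /mask mul_mx_diag !mxE; case: ifP; rewrite ?mulr1 ?mulr0.
Qed.

Lemma mask_mulE (K : {set 'I_n}) (y : 'cV_n) l :
  (mask K *m y) l 0 = if l \in K then y l 0 else 0.
Proof.
by rewrite /mask mul_diag_mx !mxE; case: ifP; rewrite ?mul1r ?mul0r.
Qed.

Hypothesis nested : forall i j,
  (row_support i \subset row_support j) || (row_support j \subset row_support i).

(** Induction on [#|S|], splitting off a row of least support. One [B] serves all [b] and [C]. *)
Lemma nested_completion (S : {set 'I_m}) :
  exists2 B : 'M[F]_(m, n), {in S, forall i, completes_row i (row i B)} &
  forall b (C : 'M[F]_(\sum_(i < m) b, \sum_(j < n) b)),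
    {in S, forall i, completes_block_row i C} ->
    (b * \rank (\sum_(i in S) <<row i B>>)%MS
       <= \rank (\sum_(i in S) <<submxcol C i>>)%MS)%N.
Proof.
have [k] := ubnP #|S|; elim: k S => // k IHk S.
have [->|[i0 i0S]] := set_0Vmem S.
  by exists 0 => [i|b C _]; rewrite ?inE // !big_set0 mxrank0 muln0.
rewrite ltnS => leSk.
case: (@arg_minnP _ i0 [in S] (fun i => #|row_support i|) i0S) => i iS min_i.
have subK j : j \in S -> row_support i \subset row_support j.
  move=> jS; have /orP[//|sji] := nested i j.
  have /eqP -> // : row_support j == row_support i.
  by rewrite eqEcard sji; apply: min_i.
have [|B cB rB] := IHk (S :\ i).
  by move: leSk; rewrite (cardsD1 i S) [i \in S]iS.
pose K := row_support i.
pose Sp : 'M_n := (\sum_(j in S :\ i) <<row j B>>)%MS.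
pose fill : 'rV[F]_n := \row_l odflt 0 (A i l).
pose update v := \matrix_j (if j == i then v else row j B).
have c_update v : completes_row i v ->
    {in S, forall j, completes_row j (row j (update v))}.
  move=> cv j jS; rewrite rowK; case: eqP => [->//|/eqP ji].
  by apply: cB; rewrite !inE ji.
have sum_update v : (\sum_(j in S) <<row j (update v)>> :=: v + Sp)%MS.
  rewrite (big_setD1 i) //= rowK eqxx.
  apply: adds_eqmx; first exact: genmxE.
  apply: eqmx_sums => j; rewrite !inE => /andP[/negPf ji _].
  by rewrite rowK ji.
have c_fill : completes_row i fill by move=> l a Ail; rewrite mxE Ail.
have [in_span|not_in_span] := boolP (fill *m mask K <= Sp *m mask K)%MS.
  have /submxP[u def_fill] := in_span.
  (* The combination [u] matches [fill] on [K]; off [K] its own values are taken, so the new row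
     stays in the span [Sp]. *)
  have cv : completes_row i (u *m Sp).
    move=> l a Ail; have lK : l \in K by rewrite inE Ail.
    have /rowP/(_ l) := def_fill.
    by rewrite mulmxA !mul_maskE lK => <-; apply: c_fill.
  exists (update (u *m Sp)) => [|b C cC]; first exact: c_update.
  rewrite sum_update (eqmxP _ : (_ + Sp :=: Sp)%MS); last first.
    by rewrite addsmxSr addsmx_sub submxMl submx_refl.
  apply: leq_trans (rB b C _) _.
    by move=> j /setD1P[_ jS]; apply: cC.
  by apply: mxrankS; rewrite [X in (_ <= X)%MS](big_setD1 i) //= addsmxSr.
exists (update fill) => [|b C cC]; first exact: c_update.
rewrite sum_update.
have [y Spy filly] := submx_separation not_in_span.
(* Masking confines the separating vector to [K], which by minimality lies in the support of every
   row of [S]. *)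
pose z := mask K *m y.
have z0 j l : j \in S -> l \notin row_support j -> z l 0 = 0.
  move=> jS lj; rewrite /z mask_mulE; case: ifP => // lK.
  by case/negP: lj; apply: subsetP lK; apply: subK.
pose Y := \mxcol_(l < n) ((z l 0)%:M : 'M[F]_b).
pose U := (\sum_(j in S :\ i) <<submxcol C j>>)%MS.
have UY : U *m Y = 0.
  apply/sub_kermxP/sumsmx_subP => j jSi; rewrite genmxE; apply/sub_kermxP.
  have /setD1P[_ jS] := jSi.
  rewrite (block_row_mul (cB j jSi) (cC j jS)) => [|l]; last exact: z0.
  suff -> : row j B *m z = 0 by rewrite mxE raddf0.
  have /submxP[u ->] : (row j B <= Sp)%MS.
    by apply: (sumsmx_sup j); rewrite ?genmxE.
  by rewrite -mulmxA /z (mulmxA Sp) Spy mulmx0.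
have VY : \rank (submxcol C i *m Y) = b.
  rewrite (block_row_mul c_fill (cC i iS)) => [|l]; last exact: z0.
  by rewrite /z mulmxA filly mxE eqxx mxrank1.
have := mxrank_adds_annihilated UY VY.
rewrite [X in _ -> (_ <= \rank X)%N](big_setD1 i) //= addsmxC.
rewrite (adds_eqmx (genmxE _) (eqmx_refl U)); apply: leq_trans.
(* The new row adds at most 1 to the rank for [B], against at least [b] for [C]. *)
apply: leq_trans (_ : (b * (1 + \rank Sp) <= _)%N).
  rewrite leq_mul2l; apply/orP; right.
  apply: leq_trans (mxrank_adds_leqif _ _) _.
  by rewrite leq_add2r rank_leq_row.
rewrite mulnDr muln1 addnC leq_add2r; apply: rB => j /setD1P[_ jS].
exact: cC.
Qed.

Lemma nested_mr_tensor b : (b * mr A <= mr (tensor_id A b))%N.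
Proof.
have [B cB rB] := nested_completion [set: 'I_m].
have [C /completion_tensorP cC <-] := mr_attained (tensor_id A b).
apply: (@leq_trans (b * \rank B)).
  rewrite leq_mul2l mr_le ?orbT // => i j a Aij.
  by have := cB i (in_setT i) j a Aij; rewrite mxE.
apply: (@leq_trans (b * \rank (\sum_(i in [set: 'I_m]) <<row i B>>)%MS)).
  rewrite leq_mul2l; apply/orP; right; apply/mxrankS/row_subP => i.
  by apply: (sumsmx_sup i); rewrite ?genmxE.
apply: leq_trans (rB b C _) _; first by move=> i _; apply: cC.
apply/mxrankS/sumsmx_subP => i _; rewrite genmxE.
by apply/row_subP => k; rewrite row_rowsub row_sub.
Qed.

End NestedSupports.

(** Columns [l] and [l'] witnessing the two failed inclusions would give [(i, l)] and [(j, l')] in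
    [T] with both crossed positions missing. *)
Lemma triangular_nested (F : fieldType) m n (A : pmatrix F m n)
    (T : {set 'I_m * 'I_n}) i j :
  T \subset knowns A -> triangular T ->
  (row_support (restrict A T) i \subset row_support (restrict A T) j) ||
  (row_support (restrict A T) j \subset row_support (restrict A T) i).
Proof.
move=> /subsetP TA /forall_inP triT.
have inK k l : (l \in row_support (restrict A T) k) = ((k, l) \in T).
  rewrite inE mxE; case: ifP => // klT.
  by have := TA _ klT; rewrite inE.
apply: contraT => /norP[/subsetPn[l]]; rewrite !inK => il njl.
case/subsetPn => l'; rewrite !inK => jl' nil'.
have /forall_inP/(_ _ jl') := triT _ il.
by rewrite (negPf njl) (negPf nil').
Qed.

Lemma triangular_mr_tensor (F : fieldType) m n (A : pmatrix F m n)
    (T : {set 'I_m * 'I_n}) b :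
  T \subset knowns A -> triangular T ->
  (b * mr (restrict A T) <= mr (tensor_id A b))%N.
Proof.
move=> TA triT.
apply: (@leq_trans (mr (tensor_id (restrict A T) b))).
  by apply: nested_mr_tensor => i j; apply: triangular_nested.
(* Restriction only drops constraints, so an optimal completion for [A] also completes the
   restricted tensor. *)
have [C /completion_tensorP cC <-] := mr_attained (tensor_id A b).
apply/mr_le/completion_tensorP => i j a.
by rewrite mxE; case: ifP => // _; apply: cC.
Qed.

Theorem theorem2p6 (R : realType) (F : fieldType) (m n : nat)
    (A : pmatrix F m n) :
  (tmr A)%:R <= fmr R A /\ fmr R A <= (mr A)%:R.
Proof.
have [ne lb] := has_inf_fmr_set R A.
split.
  apply: lb_le_inf ne _ => _ [b b_gt0 ->].
  rewrite ler_pdivlMr ?ltr0n // -natrM ler_nat mulnC /tmr.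
  apply: (big_ind (fun r => b * r <= _)%N) => [|r1 r2 le1 le2|T].
  - by rewrite muln0.
  - by rewrite maxnMr geq_max le1.
  by move=> /maxsetp/andP[triT TA]; apply: triangular_mr_tensor.
(* The infimum is at most its term at [b = 1]. *)
apply: (@le_trans _ _ ((mr (tensor_id A 1))%:R / 1%:R)).
  by apply: ge_inf lb _ _; exists 1%N.
by rewrite divr1 ler_nat -[mr A]mul1n mr_tensor_le.
Qed.
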